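(* Suppose that $F,G\in\mathcal{P}$, that $\mu$ is a Borel measure on $(0,1)$, that $a<b$ with $[a,b]\subseteq I$, and that the expected score $\mathbb{E}_F\,\mathrm{GDS}_{\mathrm d}(x,Y;G,\mu)$ is finite for every $x\in[a,b]$. If $\chi$ is a crossing point for $F$ on $[a,b]$ with respect to $G$, then $$\mathbb{E}_F\,\mathrm{GDS}_{\mathrm d}(\chi,Y;G,\mu)\le\mathbb{E}_F\,\mathrm{GDS}_{\mathrm d}(x,Y;G,\mu)$$ for all $x\in[a,b]$.
   Context: Let $I\subseteq\mathbb{R}$ be an interval. $\mathcal{P}$ is the class of Borel probability measures on $\mathbb{R}$ with mass concentrated in $I$; each $F\in\mathcal{P}$ is identified with its right-continuous CDF. $\mathbb{E}_F h(Y)$ denotes the expectation of $h(Y)$ when $Y$ has distribution $F$. The measure $\mu$ is not necessarily a probability measure. $\mathbf{1}$ denotes the indicator function. For $G\in\mathcal{P}$ and $\alpha\in(0,1)$, $G^{-1}(\alpha)=\min\{z\in\mathbb{R}:G(z)\ge\alpha\}$, and $\mathcal{R}(G)=\{\alpha\in(0,1): G(z)=\alpha \text{ for some } z\in\mathbb{R}\}$. The generalized diagonal score for single-valued forecasts is, for $x,y\in I$, $$\mathrm{GDS}_{\mathrm d}(x,y;G,\mu)=\int_{\mathcal{R}(G)}(\mathbf{1}\{y<x\}-\alpha)(\mathbf{1}\{G^{-1}(\alpha)<x\}-\mathbf{1}\{G^{-1}(\alpha)<y\})\,\mathrm{d}\mu(\alpha)\in[0,\infty].$$ Crossing point: for $F,G\in\mathcal{P}$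 and an interval $I_0$, a point $\chi\in I_0$ is a crossing point for $F$ on $I_0$ with respect to $G$ if $F(z)\le G(z)$ whenever $z\in(-\infty,\chi)\cap I_0$ and $F(z)\ge G(z)$ whenever $z\in[\chi,\infty)\cap I_0$. *)

(* Defs.v *)
From HB Require Import structures.
From mathcomp Require Import all_boot all_order all_algebra.
From mathcomp Require Import all_classical all_reals all_analysis.

Set Implicit Arguments.
Unset Strict Implicit.
Unset Printing Implicit Defensive.
Import Order.TTheory GRing.Theory Num.Theory.

Local Open Scope classical_set_scope.
Local Open Scope ring_scope.

Section GeneralizedDiagonalScore.
Context {R : realType}.

Definition prob_on (I : interval R) : set (probability (measurableTypeR R) R) :=
  [set F | F [set` I] = 1%E].

(* Borel measures on ]0, 1[ are represented by the Borel measures on R that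
   vanish outside ]0, 1[; neither finiteness nor sigma-finiteness is assumed. *)
Definition measure_on01 (mu : {measure set (measurableTypeR R) -> \bar R}) :=
  mu (~` `]0, 1[%classic) = 0%E.

Definition CDF (G : probability (measurableTypeR R) R) (z : R) : R :=
  fine (G `]-oo, z]%classic).

(* The least element of {z | alpha <= G z}; it exists for 0 < alpha < 1 because
   the CDF is right-continuous with limits 0 and 1 (the default value 0
   is then irrelevant). *)
Definition quantile (G : probability (measurableTypeR R) R) (alpha : R) : R :=
  let A := [set z | alpha <= CDF G z] in xget 0 (A `&` lbound A).

Definition crange (G : probability (measurableTypeR R) R) : set R :=
  [set alpha | 0 < alpha < 1 /\ exists z, CDF G z = alpha].

Definition GDSd (x y : R) (G : probability (measurableTypeR R) R)
    (mu : {measure set (measurableTypeR R) -> \bar R}) : \bar R :=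
  (\int[mu]_(alpha in crange G)
    (((y < x)%R%:R - alpha) *
     ((quantile G alpha < x)%R%:R - (quantile G alpha < y)%R%:R))%:E)%E.

(* E_F GDS_d(x, Y; G, mu), written as an integral because the library's
   expectation is restricted to real-valued random variables and the score may
   be infinite; the score is defined for y in I, which carries all the mass
   of F. *)
Definition expected_GDSd (I : interval R) (F : probability (measurableTypeR R) R)
    (x : R) (G : probability (measurableTypeR R) R)
    (mu : {measure set (measurableTypeR R) -> \bar R}) : \bar R :=
  (\int[F]_(y in [set` I]) GDSd x y G mu)%E.

Definition crossing_point (F : probability (measurableTypeR R) R)
    (I0 : interval R) (G : probability (measurableTypeR R) R) (chi : R) : Prop :=
  [/\ chi \in I0,
      forall z, z \in `]-oo, chi[ -> z \in I0 -> CDF F z <= CDF G z &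
      forall z, z \in `[chi, +oo[ -> z \in I0 -> CDF F z >= CDF G z].

End GeneralizedDiagonalScore.

(* Main.v *)
Require Import Defs.
From HB Require Import structures.
From mathcomp Require Import all_boot all_order all_algebra.
From mathcomp Require Import all_classical all_reals all_analysis.
From mathcomp Require Import measurable_realfun lra.

Set Implicit Arguments.
Unset Strict Implicit.
Unset Printing Implicit Defensive.
Import Order.TTheory GRing.Theory Num.Theory.
Import numFieldNormedType.Exports.

Local Open Scope classical_set_scope.
Local Open Scope ring_scope.

(** Write q(alpha) for the alpha-quantile of G and, for u <= v, let B be the
    band of the levels alpha in the range of G such that u <= q(alpha) < v.
    Moving the forecast from u to v leaves the integrand of the score unchanged
    at the levels outside B, and changes it at a level alpha of B by
    1{y <= q(alpha)} - alpha.  Taking the expectation over y ~ F and using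
    G(q(alpha)) = alpha on the range of G, the expected score changes by the
    integral over B of F(q(alpha)) - G(q(alpha)) with respect to mu.  This is
    nonnegative when G <= F on [u, v[, and nonpositive when F <= G on [u, v[;
    one takes (u, v) = (chi, x) or (u, v) = (x, chi).

    Three points need care, because mu is an arbitrary measure.
    - The change is a difference of two integrals that could both be infinite, so
      it is written as the identity [expected_GDSd_step] between sums of
      nonnegative terms: the gain (1 - alpha) 1{y <= q(alpha)} and the loss
      alpha 1{q(alpha) < y}.  The integrated loss is at most the score at u, the
      integrated gain at most the score at v, hence both are finite and can be
      cancelled.
    - Exchanging the integrals over mu and F requires mu to be sigma-finite on
      B.  It is ([sigma_finite_qband]): the scores at u and v are finite for
      some common outcome y, and the sum of their integrands is positive on B,
      so that B carries a positive mu-integrable function.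
    - Measurability: the range of G is the Borel set of fixed points in ]0, 1[
      of the composition of G with its quantile function, and the score is
      monotone in y on each side of x. *)

(** * Distribution functions and quantiles *)

Section CDFQuantile.
Context {R : realType}.
Implicit Types (G : probability (measurableTypeR R) R) (alpha z : R).

Lemma CDF_nondecreasing G : nondecreasing_fun (CDF G).
Proof.
move=> x y xy; rewrite /CDF fine_le ?fin_num_measure//.
by rewrite le_measure ?inE//; exact: subitvPr.
Qed.

(* A law on the line is the law of the identity under it, so that its CDF is the
   cdf of a random variable. *)
Let idT : measurableTypeR R -> R := idfun.
HB.instance Definition _ :=
  @isMeasurableFun.Build _ _ (measurableTypeR R) R idT (@measurable_id _ _ setT).

Lemma cvg_CDFy1 G : CDF G x @[x --> +oo] --> (1 : R).
Proof. by have /fine_cvgP[_] := cvg_cdfy1 (idT : {RV G >-> R}). Qed.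

Lemma cvg_CDFNy0 G : CDF G x @[x --> -oo] --> (0 : R).
Proof. by have /fine_cvgP[_] := cvg_cdfNy0 (idT : {RV G >-> R}). Qed.

Lemma CDF_right_continuous G : right_continuous (CDF G).
Proof.
move=> x; have := @cdf_right_continuous _ _ _ _ (idT : {RV G >-> R}) x.
have -> : cdf (idT : {RV G >-> R}) x = (CDF G x)%:E.
  by rewrite /CDF fineK ?fin_num_measure.
by move/fine_cvgP => [_].
Qed.

(** At levels in ]0, 1[ the set of which the quantile is the least element does
    have a least element. *)
Lemma quantileP G alpha : 0 < alpha < 1 ->
  ([set z | alpha <= CDF G z] `&` lbound [set z | alpha <= CDF G z])
    (quantile G alpha).
Proof.
move=> /andP[a0 a1]; set A := [set z | _].
suff Ainf : (A `&` lbound A) (inf A) by apply: xgetPex; exists (inf A).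
have A0 : A !=set0.
  have h := cvgr_ge _ (@cvg_CDFy1 G) _ a1.
  near (pinfty_nbhs R) => x; exists x; near: x; exact: h.
have lbA : has_lbound A.
  have h := cvgr_lt _ (@cvg_CDFNy0 G) _ a0.
  near (ninfty_nbhs R) => x; exists x => z Az.
  rewrite leNgt; apply/negP => /ltW/(@CDF_nondecreasing G _ _).
  apply/negP; rewrite -ltNge (lt_le_trans _ Az)//; near: x; exact: h.
split; last by move=> z Az; exact: ge_inf.
rewrite /A/= leNgt; apply/negP => lt_a.
have h := cvgr_lt _ (@CDF_right_continuous G (inf A)) _ lt_a.
near (at_right (inf A)) => x.
have xa : CDF G x < alpha by near: x; exact: h.
have : inf A < x by near: x; exact: nbhs_right_gt.
move=> /(inf_lt A0)[z Az /ltW/(@CDF_nondecreasing G _ _)].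
by apply/negP; rewrite -ltNge (lt_le_trans xa).
Unshelve. all: by end_near. Qed.

(** The quantile function and the CDF form a Galois connection. *)
Lemma quantile_le G alpha z : 0 < alpha < 1 ->
  (quantile G alpha <= z) = (alpha <= CDF G z).
Proof.
move=> a01; have [qa lbq] := quantileP G a01.
apply/idP/idP; last exact: lbq.
by move=> /(@CDF_nondecreasing G _ _); exact: le_trans.
Qed.

Lemma CDF_quantile G alpha : crange G alpha -> CDF G (quantile G alpha) = alpha.
Proof.
move=> [a01 [z Gz]]; have [qa _] := quantileP G a01.
apply/eqP; rewrite eq_le [X in _ && X]qa andbT -{2}Gz.
by apply: CDF_nondecreasing; rewrite quantile_le// Gz.
Qed.

Lemma measurable_CDF G : measurable_fun [set: R] (CDF G).
Proof. by apply: nondecreasing_measurable => //; exact: CDF_nondecreasing. Qed.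

Lemma measurable_quantile G : measurable_fun (`]0, 1[ : set R) (quantile G).
Proof.
move=> _; apply: (measurability (@RGenOInfty.G R)) => //.
  exact: RGenOInfty.measurableE.
move=> /= _ [_] [r] -> <-.
rewrite (_ : _ `&` _ = `]0, 1[ `&` `]CDF G r, +oo[); first exact: measurableI.
apply/seteqP; split => a /=; rewrite !in_itv/= !andbT => -[a01].
  by rewrite ltNge quantile_le// -ltNge.
by rewrite [r < _]ltNge quantile_le// -ltNge.
Qed.

Lemma crangeE G : crange G = `]0, 1[ `&` [set a | CDF G (quantile G a) == a].
Proof.
apply/seteqP; split => a /=; rewrite in_itv/=.
  by move=> aG; split; [exact: aG.1|apply/eqP/CDF_quantile].
by move=> [a01 /eqP qa]; split => //; exists (quantile G a).
Qed.

Lemma measurable_crange G : measurable (crange G).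
Proof.
rewrite crangeE.
have mq : measurable_fun (`]0, 1[ : set R) (fun a => CDF G (quantile G a) == a).
  apply: measurable_fun_eqr => //.
  by apply: measurableT_comp; [exact: measurable_CDF|exact: measurable_quantile].
exact: (mq _ [set true]).
Qed.

Lemma measurable_quantile_crange G : measurable_fun (crange G) (quantile G).
Proof.
apply: measurable_funS (@measurable_quantile G) => //.
by rewrite crangeE; exact: subIsetl.
Qed.

End CDFQuantile.

(** * Integration over a set on which the measure is sigma-finite *)

Section RestrictedMeasure.
Context d (T : measurableType d) (R : realType).
Variable mu : {measure set T -> \bar R}.

(** A measure is sigma-finite on a set that carries a positive integrable
    function, by Markov's inequality on the sets where w >= 1/(n+1). *)
Lemma sigma_finite_mrestr_integral (E : set T) (mE : measurable E)
    (w : T -> R) : measurable_fun E w -> (forall x, E x -> 0 < w x) ->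
  (\int[mu]_(x in E) (w x)%:E < +oo)%E -> sigma_finite setT (mrestr mu mE).
Proof.
move=> mw w0 iw.
have mw' : measurable_fun E (EFin \o w) by exact/measurable_EFinP.
pose A n := E `&` [set x | n.+1%:R^-1%:E <= `|(w x)%:E|]%E.
have mA n : measurable (A n).
  by apply: emeasurable_fun_c_infty => //; exact: measurableT_comp.
exists (fun n => ~` E `|` A n).
  apply/esym; rewrite -subTset => x _.
  have [Ex|nEx] := pselect (E x); last by exists 0%N => //; left.
  exists (Num.truncn (w x)^-1) => //; right; split => //=.
  rewrite lee_fin gtr0_norm ?w0// invf_ple ?posrE// ?w0//.
  exact/ltW/truncnS_gt.
move=> n; split; first by apply: measurableU => //; exact: measurableC.
rewrite /= /mrestr setIUl setICl set0U (setIidl (@subIsetl _ _ _)).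
have n0 : 0 < n.+1%:R^-1 :> R by rewrite invr_gt0.
have /le_lt_trans := le_integral_abse mu mE mw' n0.
rewrite (eq_integral (EFin \o w)) => [/(_ _ iw)|x]; last first.
  by rewrite inE => Ex; rewrite /= gtr0_norm ?w0.
apply: contraTT; rewrite -!leNgt !leye_eq => /eqP ->.
by rewrite mulry gtr0_sg// mul1e.
Qed.

(** Tonelli's theorem over E when only the restriction of mu to E is
    sigma-finite. *)
Lemma tonelli_mrestr d' (T' : measurableType d') (E : set T) (mE : measurable E)
    (nu : {sigma_finite_measure set T' -> \bar R}) (f : T * T' -> \bar R) :
  sigma_finite setT (mrestr mu mE) ->
  measurable_fun setT f -> (forall z, 0 <= f z)%E ->
  (measurable_fun setT (fun y => \int[mu]_(x in E) f (x, y)) /\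
   \int[mu]_(x in E) \int[nu]_y f (x, y) =
   \int[nu]_y \int[mu]_(x in E) f (x, y))%E.
Proof.
move=> sf mf f0.
pose m : {sigma_finite_measure set T -> \bar R} :=
  HB.pack (mrestr mu mE) (Measure_isSigmaFinite.Build _ _ _ (mrestr mu mE) sf).
have mE0 g : measurable_fun setT g -> (forall x, 0 <= g x)%E ->
    (\int[mu]_(x in E) g x = \int[m]_x g x)%E.
  move=> mg g0; transitivity (\int[m]_(x in E) g x)%E.
    apply: eq_measure_integral => A mA AE.
    by rewrite /m/= /mrestr setIidl.
  rewrite [RHS](ge0_negligible_integral (measurableC mE))//; last first.
    by rewrite /m/= /mrestr setICl measure0.
  by rewrite setTD setCK.
have mfx y : measurable_fun setT (fun x => f (x, y)).
  exact: measurableT_comp.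
under eq_fun => y do rewrite mE0//.
rewrite mE0; last 2 first.
- exact: measurable_fun_fubini_tonelli_F.
- by move=> x; exact: integral_ge0.
by split; [exact: measurable_fun_fubini_tonelli_G|exact: fubini_tonelli].
Qed.

End RestrictedMeasure.

(** * The score at a single level, and its integral *)

Lemma measurable_natr_bool d (T : measurableType d) (R : realType) (D : set T)
    (f : T -> bool) :
  measurable_fun D f -> measurable_fun D (fun x => (f x)%:R : R).
Proof.
move=> mf; rewrite (_ : (fun x => _) = (fun b : bool => b%:R) \o f)//.
by apply: measurableT_comp => // _ Y _; rewrite setTI.
Qed.

Section Score.
Context {R : realType}.
Variable G : probability (measurableTypeR R) R.
Implicit Types (u v x y alpha : R).

(** The integrand of the diagonal score: the score at level alpha of the
    forecast x when y materializes. *)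
Definition dscore x y alpha : R :=
  ((y < x)%R%:R - alpha) *
  ((quantile G alpha < x)%R%:R - (quantile G alpha < y)%R%:R).

(** The levels in the range of G whose quantile lies in [u, v[. *)
Definition qband u v : set R :=
  crange G `&` [set alpha | u <= quantile G alpha < v].

Lemma measurable_qband u v : measurable (qband u v).
Proof.
have mq := @measurable_quantile_crange _ G.
have mb : measurable_fun (crange G) (fun a => u <= quantile G a < v).
  by apply: measurable_and; [exact: measurable_fun_ler|exact: measurable_fun_ltr].
exact: (mb (@measurable_crange _ G) [set true]).
Qed.

Lemma dscore_ge0 x y alpha : 0 < alpha < 1 -> 0 <= dscore x y alpha.
Proof.
rewrite /dscore => /andP[a0 a1].
have [yx|xy] := ltP y x; have [qx|xq] := ltP (quantile G alpha) x;
  have [qy|yq] := ltP (quantile G alpha) y; rewrite /= ?(mulr0n, mulr1n); lra.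
Qed.

(** Between the forecasts u and v the score changes only where the quantile lies
    in [u, v[, and there by (1 - alpha) 1{y <= q} - alpha 1{q < y}. *)
Lemma dscore_step u v y alpha : u <= v ->
  dscore v y alpha +
    (u <= quantile G alpha < v)%R%:R * (alpha * (quantile G alpha < y)%R%:R) =
  dscore u y alpha +
    (u <= quantile G alpha < v)%R%:R *
    ((1 - alpha) * (y <= quantile G alpha)%R%:R).
Proof.
rewrite /dscore => uv; set q := quantile G alpha.
by have [yu|uy] := ltP y u; have [yv|vy] := ltP y v; have [qu|uq] := ltP q u;
  have [qv|vq] := ltP q v; have [qy|yq] := ltP q y;
  rewrite /= ?(mulr0n, mulr1n); lra.
Qed.

Lemma dscore_qband_gt0 u v y alpha : 0 < alpha < 1 ->
  u <= quantile G alpha < v -> 0 < dscore u y alpha + dscore v y alpha.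
Proof.
rewrite /dscore => /andP[a0 a1]; set q := quantile G alpha => /andP[uq qv].
by have [yu|uy] := ltP y u; have [yv|vy] := ltP y v; have [qy|yq] := ltP q y;
  rewrite (ltNge q u) uq qv /= ?(mulr0n, mulr1n); lra.
Qed.

(** The score does not decrease as the outcome moves away from the forecast x,
    to the right here and to the left in [dscore_nhomo]. *)
Lemma dscore_homo x y z alpha : 0 < alpha < 1 -> x <= y -> y <= z ->
  dscore x y alpha <= dscore x z alpha.
Proof.
rewrite /dscore => /andP[a0 a1]; set q := quantile G alpha => xy yz.
by have [yx|_] := ltP y x; have [zx|_] := ltP z x; have [qx|xq] := ltP q x;
  have [qy|yq] := ltP q y; have [qz|zq] := ltP q z;
  rewrite /= ?(mulr0n, mulr1n); lra.
Qed.

Lemma dscore_nhomo x y z alpha : 0 < alpha < 1 -> z < x -> y <= z ->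
  dscore x z alpha <= dscore x y alpha.
Proof.
rewrite /dscore => /andP[a0 a1]; set q := quantile G alpha => zx yz.
by have [yx|xy] := ltP y x; have [_|_] := ltP z x; have [qx|xq] := ltP q x;
  have [qy|yq] := ltP q y; have [qz|zq] := ltP q z;
  rewrite /= ?(mulr0n, mulr1n); lra.
Qed.

Lemma measurable_dscore x y : measurable_fun (crange G) (dscore x y).
Proof.
have mq := @measurable_quantile_crange _ G.
apply: measurable_funM; apply: measurable_funB => //;
  by apply: measurable_natr_bool; apply: measurable_fun_ltr.
Qed.

Section Measure.
Variable mu : {measure set (measurableTypeR R) -> \bar R}.

Lemma GDSdE x y :
  GDSd x y G mu = (\int[mu]_(alpha in crange G) (dscore x y alpha)%:E)%E.
Proof. by []. Qed.

Lemma GDSd_ge0 x y : (0 <= GDSd x y G mu)%E.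
Proof.
by apply: integral_ge0 => a [a01 _]; rewrite lee_fin; exact: dscore_ge0.
Qed.

Lemma le_GDSd x y x' y' :
  (forall alpha, 0 < alpha < 1 -> dscore x y alpha <= dscore x' y' alpha) ->
  (GDSd x y G mu <= GDSd x' y' G mu)%E.
Proof.
move=> h; apply: ge0_le_integral => //.
- exact: measurable_crange.
- by move=> a [a01 _]; rewrite lee_fin; exact: dscore_ge0.
- by apply/measurable_EFinP; exact: measurable_dscore.
- by apply/measurable_EFinP; exact: measurable_dscore.
- by move=> a [a01 _]; rewrite lee_fin; exact: h.
Qed.

(** No sigma-finiteness is available here: monotonicity in y on each side of x
    makes the upper level sets unions of two intervals. *)
Lemma measurable_GDSd x :
  measurable_fun [set: measurableTypeR R] (fun y => GDSd x y G mu).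
Proof.
move=> _; apply: (measurability _ (ErealGenCInfty.measurableE R)) => //.
move=> /= _ [_ [c ->] <-]; rewrite setTI; set A := _ @^-1` _.
have AE y : A y = (c%:E <= GDSd x y G mu)%E.
  by rewrite /A/= in_itv/= andbT.
rewrite (_ : A = (A `&` `]-oo, x[) `|` (A `&` `[x, +oo[)); last first.
  by rewrite -setIUr -itv_bndbnd_setU// set_itvNyy setIT.
apply: measurableU; apply: is_interval_measurable => s t/=;
  rewrite !AE !in_itv/= ?andbT => -[cs sx] [ct tx] r /andP[sr rt].
- have rx := le_lt_trans rt tx.
  split => //.
  rewrite AE; apply: le_trans ct _; apply: le_GDSd => a a01.
  exact: dscore_nhomo.
- have xr := le_trans sx sr.
  rewrite in_itv/= xr; split => //; rewrite AE.
  apply: le_trans cs _; apply: le_GDSd => a a01.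
  exact: dscore_homo.
Qed.

End Measure.
End Score.

(** * Expected score differences *)

Section ExpectedScore.
Context {R : realType}.
Variables (F G : probability (measurableTypeR R) R).
Variable mu : {measure set (measurableTypeR R) -> \bar R}.
Implicit Types (u v x y alpha : R).

Lemma expected_GDSdE (I : interval R) x : prob_on I F ->
  expected_GDSd I F x G mu = (\int[F]_y GDSd x y G mu)%E.
Proof.
move=> FI; have mI : measurable [set` I] by exact: measurable_itv.
transitivity (\int[F]_(y in setT `\` ~` [set` I]) GDSd x y G mu)%E.
  by rewrite setTD setCK.
apply/esym/ge0_negligible_integral => //.
- exact: measurableC.
- exact: measurable_GDSd.
- by move=> y _; exact: GDSd_ge0.
- by rewrite -[LHS]/(F _) probability_setC// FI subee.
Qed.

(** The decrease alpha 1{q < y} of the score at level alpha when the forecast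
    moves from u to v, extended by 0 outside the band.  The quantile function is
    cut off outside ]0, 1[ to make the expression jointly measurable on the
    whole plane. *)
Definition loss u v alpha y : R :=
  (\1_(qband G u v) alpha : R) *
  (alpha * ((quantile G \_ `]0, 1[) alpha < y)%R%:R).

(** The increase (1 - alpha) 1{y <= q}, with the same conventions. *)
Definition gain u v alpha y : R :=
  (\1_(qband G u v) alpha : R) *
  ((1 - alpha) * (y <= (quantile G \_ `]0, 1[) alpha)%R%:R).

Lemma qband01 u v alpha : qband G u v alpha -> 0 < alpha < 1.
Proof. by move=> [[]]. Qed.

Lemma patch_quantile u v alpha : qband G u v alpha ->
  (quantile G \_ `]0, 1[) alpha = quantile G alpha.
Proof. by move=> /qband01 a01; rewrite patchE mem_set//= in_itv. Qed.

Lemma loss_ge0 u v alpha y : 0 <= loss u v alpha y.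
Proof.
rewrite /loss indicE.
have [/set_mem/qband01/andP[a0 _]|_] := boolP (alpha \in _).
  by rewrite mul1r mulr_ge0// ltW.
by rewrite mul0r.
Qed.

Lemma gain_ge0 u v alpha y : 0 <= gain u v alpha y.
Proof.
rewrite /gain indicE.
have [/set_mem/qband01/andP[_ a1]|_] := boolP (alpha \in _).
  by rewrite mul1r mulr_ge0// subr_ge0 ltW.
by rewrite mul0r.
Qed.

Let mq : measurable_fun setT (quantile G \_ `]0, 1[).
Proof.
apply/(measurable_restrictT _ _).1 => //; exact: measurable_quantile.
Qed.

Lemma measurable_loss u v :
  measurable_fun setT (fun z : measurableTypeR R * measurableTypeR R =>
    loss u v z.1 z.2).
Proof.
apply: measurable_funM.
  apply: measurableT_comp => //; apply: measurable_indic.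
  exact: measurable_qband.
apply: measurable_funM => //; apply: measurable_natr_bool.
apply: measurable_fun_ltr => //.
exact: (measurableT_comp mq).
Qed.

Lemma measurable_gain u v :
  measurable_fun setT (fun z : measurableTypeR R * measurableTypeR R =>
    gain u v z.1 z.2).
Proof.
apply: measurable_funM.
  apply: measurableT_comp => //; apply: measurable_indic.
  exact: measurable_qband.
apply: measurable_funM => //; first exact: measurable_funB.
apply: measurable_natr_bool.
apply: measurable_fun_ler => //.
exact: (measurableT_comp mq).
Qed.

Lemma int_loss u v alpha : qband G u v alpha ->
  (\int[F]_y (loss u v alpha y)%:E =
   (alpha * (1 - CDF F (quantile G alpha)))%:E)%E.
Proof.
move=> Ea; have /andP[a0 _] := qband01 Ea.
transitivity (\int[F]_y (alpha%:E * (\1_(`]quantile G alpha, +oo[) y)%:E))%E.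
  apply: eq_integral => y _.
  rewrite /loss indicE mem_set// mul1r (patch_quantile Ea) -EFinM indicE.
  by rewrite mem_setE in_itv/= andbT.
rewrite ge0_integralZl ?lee_fin ?(ltW a0)//; last first.
  by apply/measurable_EFinP; exact: measurable_indic.
rewrite integral_indic// setIT -setCitvl.
have /= -> := probability_setC F (measurable_itv `]-oo, quantile G alpha]).
by rewrite EFinM EFinB /CDF fineK// fin_num_measure.
Qed.

Lemma int_gain u v alpha : qband G u v alpha ->
  (\int[F]_y (gain u v alpha y)%:E =
   ((1 - alpha) * CDF F (quantile G alpha))%:E)%E.
Proof.
move=> Ea; have /andP[_ a1] := qband01 Ea.
transitivity (\int[F]_y
    ((1 - alpha)%:E * (\1_(`]-oo, quantile G alpha]) y)%:E))%E.
  apply: eq_integral => y _.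
  rewrite /gain indicE mem_set// mul1r (patch_quantile Ea) -EFinM indicE.
  by rewrite mem_setE in_itv/=.
rewrite ge0_integralZl ?lee_fin ?subr_ge0 ?(ltW a1)//; last first.
  by apply/measurable_EFinP; exact: measurable_indic.
rewrite integral_indic// setIT.
by rewrite EFinM /CDF fineK// fin_num_measure.
Qed.

Let measurable_loss_l u v y (D : set (measurableTypeR R)) :
  measurable_fun D (fun a => loss u v a y).
Proof.
apply: measurable_funTS.
exact: (measurableT_comp (measurable_loss u v) (measurable_pair2 y)).
Qed.

Let measurable_gain_l u v y (D : set (measurableTypeR R)) :
  measurable_fun D (fun a => gain u v a y).
Proof.
apply: measurable_funTS.
exact: (measurableT_comp (measurable_gain u v) (measurable_pair2 y)).
Qed.

Let qband_sub u v : qband G u v `<=` crange G.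
Proof. exact: subIsetl. Qed.

Lemma le_integral_GDSd u v x y (f : R -> R) :
  measurable_fun (qband G u v) f ->
  (forall a, qband G u v a -> 0 <= f a <= dscore G x y a) ->
  (\int[mu]_(a in qband G u v) (f a)%:E <= GDSd x y G mu)%E.
Proof.
move=> mf f0; have mE := @measurable_qband _ G u v.
have md : measurable_fun (crange G) (EFin \o dscore G x y).
  by apply/measurable_EFinP; exact: measurable_dscore.
apply: (@le_trans _ _ (\int[mu]_(a in qband G u v) (dscore G x y a)%:E)%E).
  apply: ge0_le_integral => //.
  - by move=> a /f0/andP[f1 f2]; rewrite ?lee_fin.
  - exact/measurable_EFinP.
  - by apply: measurable_funS md; [exact: measurable_crange|exact: qband_sub].
  - by move=> a /f0/andP[f1 f2]; rewrite ?lee_fin.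
apply: ge0_subset_integral => //; first exact: measurable_crange.
by move=> a [a01 _]; rewrite lee_fin dscore_ge0.
Qed.

Lemma le_int_loss u v y :
  (\int[mu]_(a in qband G u v) (loss u v a y)%:E <= GDSd u y G mu)%E.
Proof.
apply: le_integral_GDSd; first exact: measurable_loss_l.
move=> a Ea; rewrite loss_ge0/= /loss indicE mem_set// mul1r.
rewrite (patch_quantile Ea); have /andP[a0 a1] := qband01 Ea.
case: Ea => _ /= /andP[uq _]; rewrite /dscore (ltNge (quantile G a) u) uq.
set q := quantile G a in uq *.
by have [yu|uy] := ltP y u; have [qy|yq] := ltP q y;
  rewrite /= ?(mulr0n, mulr1n); lra.
Qed.

Lemma le_int_gain u v y :
  (\int[mu]_(a in qband G u v) (gain u v a y)%:E <= GDSd v y G mu)%E.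
Proof.
apply: le_integral_GDSd; first exact: measurable_gain_l.
move=> a Ea; rewrite gain_ge0/= /gain indicE mem_set// mul1r.
rewrite (patch_quantile Ea); have /andP[a0 a1] := qband01 Ea.
case: Ea => _ /= /andP[_ qv]; rewrite /dscore qv.
set q := quantile G a in qv *.
by have [yv|vy] := ltP y v; have [qy|yq] := ltP q y;
  rewrite /= ?(mulr0n, mulr1n); lra.
Qed.

Let integral_qband_crange u v (f : R -> R) :
  (forall a, ~ qband G u v a -> f a = 0) ->
  (\int[mu]_(a in qband G u v) (f a)%:E = \int[mu]_(a in crange G) (f a)%:E)%E.
Proof.
move=> f0; rewrite /qband integral_mkcondr; apply: eq_integral => a /set_mem Ga.
by rewrite patchE; case: ifPn => // /negP na; rewrite f0// => -[_ /mem_set].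
Qed.

Lemma GDSd_step u v y : u <= v ->
  (GDSd v y G mu + \int[mu]_(a in qband G u v) (loss u v a y)%:E =
   GDSd u y G mu + \int[mu]_(a in qband G u v) (gain u v a y)%:E)%E.
Proof.
move=> uv; have mG := @measurable_crange _ G.
have md x : measurable_fun (crange G) (EFin \o dscore G x y).
  by apply/measurable_EFinP; exact: measurable_dscore.
rewrite !integral_qband_crange => [|a na|a na]; last 2 first.
- by rewrite /gain indicE memNset// mul0r.
- by rewrite /loss indicE memNset// mul0r.
rewrite !GDSdE -!ge0_integralD//;
  do ?[by apply/measurable_EFinP; exact: measurable_loss_l
      |by apply/measurable_EFinP; exact: measurable_gain_l |exact: md];
  do ?by
  move=> a [a01 _]; rewrite lee_fin ?loss_ge0 ?gain_ge0 ?dscore_ge0.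
apply: eq_integral => a /set_mem Ga; rewrite -!EFinD; congr (_%:E).
have a01 := Ga.1.
have qE : (quantile G \_ `]0, 1[) a = quantile G a.
  by rewrite patchE mem_set//= in_itv.
rewrite /loss /gain qE.
have -> : \1_(qband G u v) a = (u <= quantile G a < v)%R%:R :> R.
  rewrite indicE; congr (nat_of_bool _)%:R; apply/idP/idP => [/set_mem[]//|uqv].
  by apply/mem_set; split.
exact: dscore_step.
Qed.

(** Finiteness of the two expected scores yields an outcome y at which both
    scores are finite; the sum of their integrands at y is positive on the
    band. *)
Lemma sigma_finite_qband u v : u <= v ->
  (\int[F]_y GDSd u y G mu < +oo)%E -> (\int[F]_y GDSd v y G mu < +oo)%E ->
  sigma_finite setT (mrestr mu (@measurable_qband _ G u v)).
Proof.
move=> uv Eu Ev.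
have [y Sy] : exists y, (GDSd u y G mu + GDSd v y G mu < +oo)%E.
  (* otherwise the integral of the sum of the two scores would be infinite *)
  apply: contrapT => /forallNP h.
  have : (\int[F]_y (GDSd u y G mu + GDSd v y G mu) < +oo)%E.
    rewrite ge0_integralD//;
      do ?[by move=> *; exact: GDSd_ge0|exact: measurable_GDSd].
    exact: lte_add_pinfty.
  rewrite (eq_integral (cst +oo%E)) => [|y _]; last first.
    by apply/eqP; rewrite -leye_eq leNgt; exact/negP/h.
  by rewrite integral_cst// [X in (_ * X)%E](@probability_setT _ _ _ F) mule1.
pose w a := dscore G u y a + dscore G v y a.
have sub : qband G u v `<=` crange G by exact: subIsetl.
have mG := @measurable_crange _ G.
have mw : measurable_fun (crange G) w.
  by apply: measurable_funD; exact: measurable_dscore.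
apply: (@sigma_finite_mrestr_integral _ _ _ mu _ _ w).
- exact: measurable_funS mw.
- by move=> a Ea; apply: dscore_qband_gt0; [exact: qband01 Ea|exact: Ea.2].
- apply: le_lt_trans Sy; rewrite !GDSdE -ge0_integralD//; last 4 first.
  + by move=> a [a01 _]; rewrite lee_fin dscore_ge0.
  + by apply/measurable_EFinP; exact: measurable_dscore.
  + by move=> a [a01 _]; rewrite lee_fin dscore_ge0.
  + by apply/measurable_EFinP; exact: measurable_dscore.
  apply: ge0_subset_integral => //; first exact: measurable_qband.
    exact/measurable_EFinP.
  by move=> a [a01 _]; rewrite lee_fin addr_ge0// dscore_ge0.
Qed.

(** The expectations under F of the loss and of the gain integrated over the
    band, after exchanging the integrals. *)
Definition expected_loss u v : \bar R := (\int[mu]_(a in qband G u v)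
  (a * (1 - CDF F (quantile G a)))%:E)%E.

Definition expected_gain u v : \bar R := (\int[mu]_(a in qband G u v)
  ((1 - a) * CDF F (quantile G a))%:E)%E.

(** The two bounds give the finiteness needed to cancel in the identity. *)
Lemma expected_GDSd_step u v : u <= v ->
  (\int[F]_y GDSd u y G mu < +oo)%E -> (\int[F]_y GDSd v y G mu < +oo)%E ->
  [/\ (expected_loss u v <= \int[F]_y GDSd u y G mu)%E,
      (expected_gain u v <= \int[F]_y GDSd v y G mu)%E &
      (\int[F]_y GDSd v y G mu + expected_loss u v =
       \int[F]_y GDSd u y G mu + expected_gain u v)%E].
Proof.
move=> uv Eu Ev; have sf := sigma_finite_qband uv Eu Ev.
have [mlo lo] := @tonelli_mrestr _ _ _ mu _ _ _ _ F
  (fun z => (loss u v z.1 z.2)%:E) sf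
  ((measurable_EFinP _ _).2 (measurable_loss u v)) (fun z => loss_ge0 u v z.1 z.2).
have [mup up] := @tonelli_mrestr _ _ _ mu _ _ _ _ F
  (fun z => (gain u v z.1 z.2)%:E) sf
  ((measurable_EFinP _ _).2 (measurable_gain u v)) (fun z => gain_ge0 u v z.1 z.2).
have loE : (expected_loss u v =
    \int[F]_y \int[mu]_(a in qband G u v) (loss u v a y)%:E)%E.
  by rewrite -lo; apply: eq_integral => a /set_mem Ea; rewrite /= int_loss.
have upE : (expected_gain u v =
    \int[F]_y \int[mu]_(a in qband G u v) (gain u v a y)%:E)%E.
  by rewrite -up; apply: eq_integral => a /set_mem Ea; rewrite /= int_gain.
have lo0 y : (0 <= \int[mu]_(a in qband G u v) (loss u v a y)%:E)%E.
  by apply: integral_ge0 => a _; rewrite lee_fin loss_ge0.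
have up0 y : (0 <= \int[mu]_(a in qband G u v) (gain u v a y)%:E)%E.
  by apply: integral_ge0 => a _; rewrite lee_fin gain_ge0.
have mS x := @measurable_GDSd _ G mu x.
have S0 x y := @GDSd_ge0 _ G mu x y.
rewrite loE upE; split.
- apply: ge0_le_integral; [exact: measurableT|by []|exact: mlo|exact: mS|].
  by move=> y _; exact: le_int_loss.
- apply: ge0_le_integral; [exact: measurableT|by []|exact: mup|exact: mS|].
  by move=> y _; exact: le_int_gain.
- transitivity (\int[F]_y (GDSd v y G mu +
      \int[mu]_(a in qband G u v) (loss u v a y)%:E))%E.
    by apply/esym/ge0_integralD; [exact: measurableT|by []|exact: mS|by []|exact: mlo].
  transitivity (\int[F]_y (GDSd u y G mu +
      \int[mu]_(a in qband G u v) (gain u v a y)%:E))%E.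
    by apply: eq_integral => y _; exact: GDSd_step.
  by apply/ge0_integralD; [exact: measurableT|by []|exact: mS|by []|exact: mup].
Qed.

Lemma measurable_CDF_quantile u v :
  measurable_fun (qband G u v) (fun a => CDF F (quantile G a)).
Proof.
apply: (@measurable_funS _ _ _ _ (crange G)); first exact: measurable_crange.
  exact: qband_sub.
apply: measurableT_comp; first exact: measurable_CDF.
exact: measurable_quantile_crange.
Qed.

Let expected_loss_fun u v : measurable_fun (qband G u v)
  (fun a => (a * (1 - CDF F (quantile G a)))%:E).
Proof.
apply/measurable_EFinP; apply: measurable_funM => //.
by apply: measurable_funB => //; exact: measurable_CDF_quantile.
Qed.

Let expected_gain_fun u v : measurable_fun (qband G u v)
  (fun a => ((1 - a) * CDF F (quantile G a))%:E).
Proof.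
apply/measurable_EFinP; apply: measurable_funM;
  last exact: measurable_CDF_quantile.
exact: measurable_funB.
Qed.

Let CDF01 z : 0 <= CDF F z <= 1.
Proof.
by rewrite fine_ge0//= -lee_fin /CDF fineK ?fin_num_measure ?probability_le1.
Qed.

Let expected_loss_fun_ge0 u v a : qband G u v a ->
  (0 <= (a * (1 - CDF F (quantile G a)))%:E)%E.
Proof.
move=> /qband01/andP[a0 _]; have /andP[_ h] := CDF01 (quantile G a).
by rewrite lee_fin mulr_ge0 ?subr_ge0// ltW.
Qed.

Let expected_gain_fun_ge0 u v a : qband G u v a ->
  (0 <= ((1 - a) * CDF F (quantile G a))%:E)%E.
Proof.
move=> /qband01/andP[_ a1]; have /andP[h _] := CDF01 (quantile G a).
by rewrite lee_fin mulr_ge0 ?subr_ge0// ltW.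
Qed.

(** On the band, G at the quantile is alpha, so G <= F makes the loss at most
    alpha (1 - alpha), and the gain at least that. *)
Lemma expected_GDSd_le u v : u <= v ->
  (\int[F]_y GDSd u y G mu < +oo)%E -> (\int[F]_y GDSd v y G mu < +oo)%E ->
  (forall z, u <= z < v -> CDF G z <= CDF F z) ->
  (\int[F]_y GDSd u y G mu <= \int[F]_y GDSd v y G mu)%E.
Proof.
move=> uv Eu Ev GF; have [loss_le _ step] := expected_GDSd_step uv Eu Ev.
have loss_gain : (expected_loss u v <= expected_gain u v)%E.
  apply: ge0_le_integral => //; first exact: measurable_qband.
  - exact: expected_loss_fun_ge0.
  - exact: expected_loss_fun.
  - exact: expected_gain_fun.
  - move=> a Ea; have := GF _ Ea.2; rewrite (CDF_quantile Ea.1) lee_fin; lra.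
have loss_fin : expected_loss u v \is a fin_num.
  rewrite ge0_fin_numE ?(le_lt_trans loss_le)//.
  by apply: integral_ge0 => a; exact: expected_loss_fun_ge0.
by rewrite -(leeD2rE _ _ loss_fin) step leeD2l.
Qed.

Lemma expected_GDSd_ge u v : u <= v ->
  (\int[F]_y GDSd u y G mu < +oo)%E -> (\int[F]_y GDSd v y G mu < +oo)%E ->
  (forall z, u <= z < v -> CDF F z <= CDF G z) ->
  (\int[F]_y GDSd v y G mu <= \int[F]_y GDSd u y G mu)%E.
Proof.
move=> uv Eu Ev FG; have [_ gain_le step] := expected_GDSd_step uv Eu Ev.
have gain_loss : (expected_gain u v <= expected_loss u v)%E.
  apply: ge0_le_integral => //; first exact: measurable_qband.
  - exact: expected_gain_fun_ge0.
  - exact: expected_gain_fun.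
  - exact: expected_loss_fun.
  - move=> a Ea; have := FG _ Ea.2; rewrite (CDF_quantile Ea.1) lee_fin; lra.
have gain_fin : expected_gain u v \is a fin_num.
  rewrite ge0_fin_numE ?(le_lt_trans gain_le)//.
  by apply: integral_ge0 => a; exact: expected_gain_fun_ge0.
by rewrite -(leeD2rE _ _ gain_fin) -step leeD2l.
Qed.

End ExpectedScore.

Theorem theorem3 (R : realType) (I : interval R)
    (F G : probability (measurableTypeR R) R)
    (mu : {measure set (measurableTypeR R) -> \bar R}) (a b chi : R) :
  prob_on I F -> prob_on I G -> measure_on01 mu ->
  a < b -> {subset `[a, b] <= I} ->
  (forall x, x \in `[a, b] -> expected_GDSd I F x G mu \is a fin_num) ->
  crossing_point F `[a, b] G chi ->
  forall x, x \in `[a, b] ->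
    (expected_GDSd I F chi G mu <= expected_GDSd I F x G mu)%E.
Proof.
move=> FI _ _ _ _ fin [chi_ab FG GF] x x_ab.
have Efin z : z \in `[a, b] -> (\int[F]_y GDSd z y G mu < +oo)%E.
  by move=> /fin; rewrite expected_GDSdE// => /fin_numPlt/andP[].
rewrite !expected_GDSdE//.
move: (chi_ab) (x_ab); rewrite !in_itv/= => /andP[achi chib] /andP[ax xb].
have [cx|/ltW xc] := leP chi x.
  apply: expected_GDSd_le; [by []|exact: Efin..|].
  move=> z /andP[cz zx]; apply: GF; rewrite in_itv/= ?cz//.
  by rewrite (le_trans achi cz) (le_trans (ltW zx)).
apply: expected_GDSd_ge; [by []|exact: Efin..|].
move=> z /andP[xz zc]; apply: FG; rewrite in_itv/= ?zc//.
by rewrite (le_trans ax xz) (le_trans (ltW zc)).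
Qed.
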